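(* Let $p$ be a prime with $p\equiv\pm1\pmod{8}$. Then $$\sum_{k=0}^{p-1}\binom{p-1}{k}\binom{2k}{k}\frac{u_k(4,2)}{(-2)^k}\equiv(-1)^{(p-1)/2}u_{p-1}(4,2)\pmod{p^3}.$$
   Context: For integers $A,B$, the Lucas sequence $u_n=u_n(A,B)$ ($n\in\mathbb N$) is defined by $u_0=0$, $u_1=1$, and $u_{n+1}=Au_n-Bu_{n-1}$ for $n\ge1$. The congruence is between rational numbers with denominators prime to $p$, understood in the ring of $p$-integral rationals. *)

(* Defs.v *)
From mathcomp Require Import all_boot all_order all_algebra.

Set Implicit Arguments.
Unset Strict Implicit.
Unset Printing Implicit Defensive.

Import GRing.Theory Num.Theory.
Local Open Scope ring_scope.

Fixpoint lucas_u (A B : int) (n : nat) : int :=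
  match n with
  | 0%N => 0
  | 1%N => 1
  | (n'.+1 as m).+1 => A * lucas_u A B m - B * lucas_u A B n'
  end.

(* [denq x] is the positive denominator of x in lowest terms. *)
Definition p_integral (p : nat) (x : rat) : bool := coprimez p%:Z (denq x).

(* Congruence modulo the ideal generated by p^e in the ring Z_(p) of p-integral
   rationals; membership of x and y in Z_(p) is part of the assertion. *)
Definition p_congr (p e : nat) (x y : rat) : Prop :=
  [/\ p_integral p x, p_integral p y &
      exists2 z : rat, p_integral p z & x - y = (p ^ e)%:R * z].

(* Main.v *)
(** Write n = p - 1 = 2h and let r be a square root of 2.  The sum over k of
    C(n,k) C(2k,k) x^k is the coefficient of X^n in (X + x (X+1)^2)^n.  At
    x = -(2 + r)/2 the quadratic factors as x (X + z/r) (X + w/r), where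
    z, w = 1 + i, 1 - i, so by Binet's formula the sum of the theorem equals
    exactly D u_n(4,2) / 8^h, with
    D = sum_k C(n,k) C(n+k,k) z^k (w-z)^(n-k).

    For 0 < k < p one has C(n,k) C(n+k,k) = -C(p,k) mod p^2, which makes the
    sum D telescope to 2 (w-z)^n - (w^p - z^p)/(w-z) = 2 (-4)^h - (-2)^h
    mod p^2, the last step using p = 1, 7 mod 8.  The Frobenius congruence
    modulo p in the algebraic integers, applied to 1 + i and to 2 + r and
    2 - r, gives 2^h = 1 mod p and p | u_n(4,2).  Hence D = (-8)^h mod p^2,
    because 2 x^2 - x - x^3 = -x (x-1)^2 with x = 2^h, and the factor u_n
    supplies the third power of p. *)

Require Import Defs.
From mathcomp Require Import all_boot all_order all_algebra.
From mathcomp Require Import all_field.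
From mathcomp Require Import zify ring.
Import GRing.Theory Num.Theory.
Local Open Scope ring_scope.

(** * Central coefficients of powers of quadratics *)

Lemma coef_exp_XaddC (R : comNzRingType) (a : R) m j :
  (('X + a%:P) ^+ m)`_j = 'C(m, j)%:R * a ^+ (m - j).
Proof.
rewrite addrC exprDn coef_sum.
under eq_bigr => i _ do
  rewrite coefMn -rmorphXn /= coefCM coefXn mulr_natr mulrnAC.
have [jm | mj] := leqP j m.
  rewrite (bigD1 (Ordinal (jm : j < m.+1)%N)) //= eqxx big1 ?addr0 ?mulr1n.
    by rewrite mulr_natl.
  move=> i /negP ne_ij; rewrite eq_sym [(_ == _)%N]negbTE ?mulr0n ?mul0rn //.
  by apply/negP=> /eqP eq_ij; apply: ne_ij; apply/eqP/val_inj.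
rewrite bin_small // mul0r big1 // => i _.
by rewrite [(_ == _)%N]gtn_eqF ?mulr0n ?mul0rn // (leq_trans (ltn_ord i)).
Qed.

(** Expand the second factor around [X + z]; each term then needs the coefficient of X^n in (X +
    z)^(n+k), which is C(n+k,n) z^k. *)
Lemma central_coef_factored (R : comNzRingType) (z w : R) n :
  ((('X + z%:P) * ('X + w%:P)) ^+ n)`_n =
    \sum_(k < n.+1)
      ('C(n, k) * 'C(n + k, k))%:R * (z ^+ k * (w - z) ^+ (n - k)).
Proof.
have -> : 'X + w%:P = (w - z)%:P + ('X + z%:P) by rewrite rmorphB /=; ring.
rewrite exprMn [(_%:P + _) ^+ n]exprDn mulr_sumr coef_sum.
apply: eq_bigr => k _.
rewrite mulrnAr coefMn mulrCA -exprD -rmorphXn /= coefCM coef_exp_XaddC.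
have -> : 'C(n + k, k) = 'C(n + k, n).
  by rewrite -(bin_sub (leq_addr k n)) addKn.
by rewrite addKn -mulr_natl natrM; ring.
Qed.

Lemma central_coef_shifted (R : comNzRingType) (x : R) n :
  (('X + x *: ('X + 1) ^+ 2) ^+ n)`_n =
    \sum_(k < n.+1) ('C(n, k) * 'C(k.*2, k))%:R * x ^+ k.
Proof.
rewrite exprDn coef_sum; apply: eq_bigr => k _.
have lekn : (k <= n)%N by rewrite -ltnS.
rewrite coefMn exprZn -exprM -scalerAr coefZ coefXnM ltnNge leq_subr /=.
rewrite subKn // (_ : 'X + 1 = 'X + 1%:P) // mul2n coef_exp_XaddC expr1n mulr1.
by rewrite -mulr_natl natrM; ring.
Qed.

(** * Binomial congruences modulo p^2 *)

Lemma bin_addl_prime_mod p m : prime p -> (m < p)%N ->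
  'C(p + m, m) = 1 %[mod p].
Proof.
move=> p_pr ltmp; rewrite -binomial.Vandermonde big_ord_recl bin0 mul1n.
rewrite subn0 binn -modnDmr (_ : ((\sum_(i < m) _) %% p)%N = 0%N) ?addn0 //.
apply/eqP.
change (p %| \sum_(i < m) 'C(p, lift ord0 i) * 'C(m, m - lift ord0 i))%N.
apply: dvdn_sum => i _.
by rewrite dvdn_mulr // prime_dvd_bin //= (leq_ltn_trans _ ltmp) //= ltn_ord.
Qed.

(** After multiplication by k, a unit mod p, absorption pulls one factor p out of each term. As
    C(p+k-1,k-1) = 1 mod p, the cofactor is C(p-1,k) + C(p-1,k-1) = C(p,k) mod p, which gives the
    second factor. *)
Lemma prime_sqr_dvd_bin p k : prime p -> (0 < k < p)%N ->
  (p ^ 2 %| 'C(p.-1, k) * 'C(p.-1 + k, k) + 'C(p, k))%N.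
Proof.
move=> p_pr /andP[k0 kp]; case: p p_pr kp => // n p_pr kp /=.
case: k k0 kp => // k _ kp.
have cop : coprime (n.+1 ^ 2) k.+1.
  by rewrite coprimeXl // prime_coprime // gtnNdvd.
have bk : (n.+1 %| 'C(n, k.+1) + 'C(n, k))%N by rewrite -binS prime_dvd_bin.
have b1 := bin_addl_prime_mod _ _ p_pr (ltnW kp).
have e1 : (k.+1 * 'C(n + k.+1, k.+1) = n.+1 * 'C(n.+1 + k, k))%N.
  by rewrite mul_bin_left addSnnS; congr (_ * _)%N; lia.
have e2 : (k.+1 * 'C(n.+1, k.+1) = n.+1 * 'C(n, k))%N by rewrite -mul_bin_diag.
rewrite -(Gauss_dvdr _ cop) mulnDr mulnCA e1 e2 mulnCA -mulnDr.
rewrite expnS expn1 dvdn_pmul2l // /dvdn -modnDml -modnMmr b1 modnMmr muln1.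
by rewrite modnDml.
Qed.

(** Multiplying by w - z turns the sum of C(p,k) z^k (w-z)^(p-1-k) over k < p into w^p - z^p with no
    division. *)
Lemma jacobi_sum_expansion (R : comNzRingType) (z w : R) n : prime n.+1 ->
  exists e : nat -> nat,
    (w - z) * (\sum_(k < n.+1)
        ('C(n, k) * 'C(n + k, k))%:R * (z ^+ k * (w - z) ^+ (n - k))) =
    2 * (w - z) ^+ n.+1 - (w ^+ n.+1 - z ^+ n.+1)
      + (n.+1 ^ 2)%:R * ((w - z) *
          \sum_(k < n.+1) (e k)%:R * (z ^+ k * (w - z) ^+ (n - k))).
Proof.
move=> p_pr; set s := w - z.
pose c k := ('C(n, k) * 'C(n + k, k))%N.
pose e k := ((c k + 'C(n.+1, k)) %/ n.+1 ^ 2)%N.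
exists e.
(* The congruence fails at k = 0: there both binomials give 1 and [e 0] is 0, whence the correction
   2. *)
have cE k : (k < n.+1)%N -> (c k)%:R =
    (n.+1 ^ 2)%:R * (e k)%:R - 'C(n.+1, k)%:R + 2 * (k == 0)%:R :> R.
  move=> lt_kp; apply: (addIr ('C(n.+1, k)%:R)).
  rewrite addrAC subrK -natrM -!natrD -natrM -natrD; congr (_%:R).
  case: k lt_kp => [_|k lt_kp] /=; last first.
    by rewrite addn0 mulnC divnK // (prime_sqr_dvd_bin _ _ p_pr).
  have p2_gt2 : (2 < n.+1 ^ 2)%N.
    by have := prime_gt1 p_pr; rewrite expnS expn1; nia.
  by rewrite /e /c !bin0 divn_small // muln0.
have wE : w ^+ n.+1 - z ^+ n.+1 =
    s * \sum_(k < n.+1) 'C(n.+1, k)%:R * (z ^+ k * s ^+ (n - k)).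
  have {1}-> : w = s + z by rewrite /s subrK.
  rewrite exprDn big_ord_recr /= subnn binn mulr1n mul1r addrK mulr_sumr.
  apply: eq_bigr => k _; rewrite -mulr_natl subSn -1?ltnS // exprS; ring.
have sE : 2 * s ^+ n.+1 =
    s * \sum_(k < n.+1) (2 * (val k == 0%N)%:R) * (z ^+ k * s ^+ (n - k)).
  rewrite big_ord_recl big1 => [|i _]; last by rewrite mulr0 mul0r.
  by rewrite subn0 addr0 /= expr0 exprS; ring.
rewrite wE sE !mulr_sumr -sumrB -big_split; apply: eq_bigr => k _ /=.
by rewrite -/(c k) (cE k (ltn_ord k)); ring.
Qed.

(** * Divisibility in the algebraic integers *)

Lemma root_sqr_Aint (x : algC) (a : int) : x ^+ 2 = a%:~R -> x \in Aint.
Proof.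
move=> x2; apply: (@root_monic_Aint ('X^2 - (a%:~R)%:P)).
- by rewrite rootE !hornerE x2 subrr.
- exact: monicXnsubC.
apply/polyOverP=> j; rewrite coefB coefXn coefC rpredB ?rpred_nat //.
by case: ifP; rewrite ?rpred0 ?rpred_int.
Qed.

(** A rational algebraic integer is an integer, so divisibility by [d] descends from the algebraic
    integers. *)
Lemma ratr_dvd_Aint (d : int) (x : rat) (E : algC) :
  d != 0 -> E \in Aint -> ratr x = d%:~R * E ->
  exists m : int, x = d%:~R * m%:~R.
Proof.
move=> d0 EA xE.
have d0' : (d%:~R : algC) != 0 by rewrite intr_eq0.
have /intrP[m Em] : E \is a Num.int.
  apply: Cint_rat_Aint => //.
  by rewrite -(mulKf d0' E) -xE rpredM ?rpredV ?rpred_int ?Crat_rat.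
exists m; apply: (fmorph_inj (ratr : {rmorphism rat -> algC})).
by rewrite rmorphM /= !ratr_int xE Em.
Qed.

Lemma dvdz_Aint (d a : int) (E : algC) :
  d != 0 -> E \in Aint -> a%:~R = d%:~R * E -> (d %| a)%Z.
Proof.
move=> d0 EA aE; have [|m] := @ratr_dvd_Aint d a%:~R E d0 EA.
  by rewrite ratr_int.
rewrite -intrM => /intr_inj ->; exact: dvdz_mulr.
Qed.

Lemma exprD_prime_Aint (p : nat) (x y : algC) :
    prime p -> x \in Aint -> y \in Aint ->
  exists2 E, E \in Aint & (x + y) ^+ p = x ^+ p + y ^+ p + p%:R * E.
Proof.
case: p => // n p_pr xA yA.
exists (\sum_(k < n) ('C(n.+1, k.+1) %/ n.+1)%:R * (x ^+ (n - k) * y ^+ k.+1)).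
  by apply: rpred_sum => k _; rewrite !rpredM ?rpredX ?rpred_nat.
rewrite exprDn big_ord_recl big_ord_recr /= subn0 bin0 binn subnn.
rewrite !expr0 mulr1 mul1r !mulr1n -addrA [X in _ + X = _]addrC.
congr (_ + (_ + _)).
rewrite mulr_sumr; apply: eq_bigr => k _.
rewrite mulrA -natrM mulnC divnK; last first.
  by rewrite prime_dvd_bin //= ltnS ltn_ord.
by rewrite mulr_natl.
Qed.

(** * Binet's formula, free of division *)

Lemma lucas_u_binet (R : comNzRingType) (a b : R) (A B : int) n :
  a + b = A%:~R -> a * b = B%:~R ->
  (a - b) * (lucas_u A B n)%:~R = a ^+ n - b ^+ n.
Proof.
move=> abA abB.
suff [] : (a - b) * (lucas_u A B n)%:~R = a ^+ n - b ^+ n /\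
  (a - b) * (lucas_u A B n.+1)%:~R = a ^+ n.+1 - b ^+ n.+1 by [].
elim: n => [|n [IH1 IH2]]; first by rewrite mulr0 mulr1 !expr0 subrr.
split=> //; rewrite [lucas_u A B n.+2]/= -/(lucas_u A B n.+1).
rewrite rmorphB !rmorphM /= -abA -abB mulrBr !(mulrCA (a - b)) IH1 IH2 !exprS.
ring.
Qed.

Lemma lucas_u42_binet (R : comNzRingType) (r : R) n : r ^+ 2 = 2 ->
  (2 + r - (2 - r)) * (lucas_u 4 2 n)%:~R = (2 + r) ^+ n - (2 - r) ^+ n.
Proof.
move=> r2; apply: lucas_u_binet; first by rewrite -[4%:~R]/(4 : R); ring.
by rewrite mulrC -subr_sqr r2 -[2%:~R]/(2 : R); ring.
Qed.

(** * Frobenius applied to 1 + i and to 2 + r, 2 - r *)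

Lemma exprn_odd_sqrtN1 h (R : comNzRingType) (i : R) :
  i ^+ 2 = -1 -> i ^+ h.*2.+1 = (-1) ^+ h * i.
Proof. by move=> i2; rewrite exprS -mul2n exprM i2 mulrC. Qed.

(** Since (1+i)^2 = 2i, only i^h (1+i) matters; the residue mod 8 forces h = 0 or 3 mod 4. *)
Lemma exprn_1Di h (R : comNzRingType) (i : R) :
    (h.*2.+1 = 1 %[mod 8] \/ h.*2.+1 = 7 %[mod 8])%N ->
  i ^+ 2 = -1 ->
  (1 + i) ^+ h.*2.+1 = 2 ^+ h * (1 + (-1) ^+ h * i).
Proof.
move=> p_mod8 i2.
have sqr_1Di : (1 + i) ^+ 2 = 2 * i by rewrite sqrrD i2; ring.
rewrite exprS -mul2n exprM sqr_1Di exprMn mulrCA; congr (_ * _).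
have i4 : i ^+ 4 = 1 by rewrite (exprM i 2 2) i2 sqrrN expr1n.
have N14 : (-1) ^+ 4 = 1 :> R by rewrite (exprM _ 2 2) sqrrN !expr1n.
have [r [hE r_03]] : exists r, (h = 4 * (h %/ 4) + r /\ (r = 0 \/ r = 3))%N.
  by exists (h %% 4)%N; lia.
rewrite hE !(exprD _ (4 * (h %/ 4))) !exprM i4 N14 !expr1n !mul1r.
case: r_03 => ->.
  by rewrite !expr0; ring.
have -> : i ^+ 3 = - i by rewrite exprS i2; ring.
have -> : (-1) ^+ 3 = -1 :> R by ring.
by rewrite mulrDl (mulrN i i) -expr2 i2; ring.
Qed.

(** Two values of (1+i)^p are compared: 2^h (1+t) exactly, and 1 + t modulo p, where t = i^p. *)
Lemma prime_dvd_2exp_half h : prime h.*2.+1 ->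
    (h.*2.+1 = 1 %[mod 8] \/ h.*2.+1 = 7 %[mod 8])%N ->
  (h.*2.+1%:Z %| 2 ^+ h - 1)%Z.
Proof.
set p := h.*2.+1 => p_pr p_mod8.
have i2 := sqrCi algC.
have iA : 'i \in Aint by apply: (@root_sqr_Aint _ (-1)); rewrite i2.
have [E EA] := exprD_prime_Aint p 1 'i p_pr (rpred1 _) iA.
rewrite exprn_1Di // expr1n exprn_odd_sqrtN1 //; set t := (-1) ^+ h * 'i => eqE.
have t2 : t ^+ 2 = -1.
  by rewrite exprMn i2 -exprM mulnC exprM sqrrN !expr1n mul1r.
have tA : t \in Aint by apply: (@root_sqr_Aint _ (-1)); rewrite t2.
(* Multiplying by 1 - t replaces 1 + t by the integer 2, which is prime to p. *)
have cop : coprimez p%:Z 2.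
  by rewrite coprimezE coprimen2 /= odd_double.
rewrite -(Gauss_dvdzr _ cop).
apply: (@dvdz_Aint _ _ (E * (1 - t))) => //.
  by rewrite rpredM ?rpredB ?rpred1.
rewrite rmorphM rmorphB rmorphXn /=.
have -> : p%:~R * (E * (1 - t)) = (p%:R * E) * (1 - t) :> algC by rewrite mulrA.
have -> : p%:R * E = (2 ^+ h - 1) * (1 + t).
  by rewrite mulrBl eqE mul1r [RHS]addrC addKr.
rewrite mulrAC -mulrA -subr_sqr expr1n t2 opprK mulrC; congr (_ * _).
Qed.

(** Modulo p, (2+r)^p = 2^p + r^p = 2 + r. Multiplying by 2 - r, whose product with 2 + r is 2,
    lowers the exponent to p - 1. *)
Lemma expr_prime_2Dsqrt2 h (r : algC) : prime h.*2.+1 ->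
    (h.*2.+1%:Z %| 2 ^+ h - 1)%Z -> r ^+ 2 = 2 ->
  exists2 E, E \in Aint & 2 * (2 + r) ^+ h.*2 = 2 + h.*2.+1%:R * E.
Proof.
set p := h.*2.+1 => p_pr /dvdzP[q qE] r2.
have rA : r \in Aint by exact: (@root_sqr_Aint _ 2).
have [E EA eqE] := exprD_prime_Aint p 2 r p_pr (rpred_nat _ 2) rA.
have pow2 : 2 ^+ h = 1 + p%:R * q%:~R :> algC.
  apply/eqP; rewrite addrC -subr_eq mulrC; apply/eqP.
  have := congr1 (fun m : int => m%:~R : algC) qE.
  by rewrite rmorphB rmorphM rmorphXn.
exists ((2 * (2 * q%:~R + p%:R * q%:~R ^+ 2) + r * q%:~R + E) * (2 - r)).
  by rewrite rpredM ?rpredB ?(rpredD, rpredM, rpredX, rpred_nat, Aint_int).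
have two_conj : (2 - r) * (2 + r) = 2 by rewrite -subr_sqr r2; ring.
have pow2p : 2 ^+ p = 2 * (1 + p%:R * q%:~R) ^+ 2 :> algC.
  by rewrite [LHS]exprS -mul2n mulnC exprM pow2.
have powrp : r ^+ p = r * (1 + p%:R * q%:~R).
  by rewrite [LHS]exprS -mul2n exprM r2 pow2.
by rewrite -{1 3}two_conj -mulrA -exprS eqE pow2p powrp; ring.
Qed.

Lemma prime_dvd_lucas_u42 h : prime h.*2.+1 ->
    (h.*2.+1%:Z %| 2 ^+ h - 1)%Z ->
  (h.*2.+1%:Z %| lucas_u 4 2 h.*2)%Z.
Proof.
set p := h.*2.+1 => p_pr dvd_2h.
pose r : algC := sqrtC 2.
have r2 : r ^+ 2 = 2 by exact: sqrtCK.
have rA : r \in Aint by exact: (@root_sqr_Aint _ 2).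
have [E EA eqE] := expr_prime_2Dsqrt2 h r p_pr dvd_2h r2.
have [F FA eqF] : exists2 F, F \in Aint & 2 * (2 - r) ^+ h.*2 = 2 + p%:R * F.
  by apply: expr_prime_2Dsqrt2; rewrite ?sqrrN.
(* Binet carries the factor 2r; multiplying by 2r more makes it the integer 8. *)
have cop : coprimez p%:Z 8.
  by rewrite coprimezE (@coprime_pexpr 3 _ 2) // coprimen2 /= odd_double.
rewrite -(Gauss_dvdzr _ cop).
apply: (@dvdz_Aint _ _ (r * (E - F))) => //; first by rewrite rpredM ?rpredB.
have binet := lucas_u42_binet _ r h.*2 r2.
rewrite rmorphM /=.
have -> : p%:~R * (r * (E - F)) = r * (2 * ((2 + r) ^+ h.*2 - (2 - r) ^+ h.*2)).
  by rewrite [2 * _]mulrBr eqE eqF -/p -[p%:~R]/(p%:R : algC); ring.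
rewrite -binet -[8%:~R]/(8 : algC).
have -> : 8 = r ^+ 2 * 4 by rewrite r2; ring.
by ring.
Qed.

(** * The exact identity over a field containing i and r *)

Lemma shifted_quadratic_factor (R : comNzRingType) (x a b : R) :
  a * b = 1 -> x * (a + b) = 2 * x + 1 ->
  'X + x *: ('X + 1) ^+ 2 = x%:P * (('X + a%:P) * ('X + b%:P)).
Proof.
move=> ab1 xab.
have -> : x%:P * (('X + a%:P) * ('X + b%:P)) =
    x%:P * 'X ^+ 2 + (x * (a + b))%:P * 'X + x%:P * (a * b)%:P.
  by rewrite !rmorphM rmorphD /=; ring.
by rewrite ab1 xab rmorphD rmorphM /= -mul_polyC rmorph1 rmorph_nat; ring.
Qed.

Lemma sum_binom_central_2Dsqrt2 (F : numFieldType) h (i r : F) :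
  i ^+ 2 = -1 -> r ^+ 2 = 2 ->
  8 ^+ h * (\sum_(k < h.*2.+1)
      ('C(h.*2, k) * 'C(k.*2, k))%:R * (- ((2 + r) / 2)) ^+ k) =
  (2 + r) ^+ h.*2 *
    \sum_(k < h.*2.+1) ('C(h.*2, k) * 'C(h.*2 + k, k))%:R *
      ((1 + i) ^+ k * ((1 - i) - (1 + i)) ^+ (h.*2 - k)).
Proof.
move=> i2 r2; set n := h.*2; set x := - _.
have r0 : r != 0 by rewrite -sqrf_eq0 r2 pnatr_eq0.
pose a := (1 + i) / r; pose b := (1 - i) / r.
have ab1 : a * b = 1.
  have -> : a * b = (1 - i ^+ 2) / r ^+ 2 by rewrite /a /b; field.
  by rewrite i2 r2; field.
have xab : x * (a + b) = 2 * x + 1.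
  apply: (mulfI r0); rewrite /x /a /b.
  have -> : r * (- ((2 + r) / 2) * ((1 + i) / r + (1 - i) / r)) = - (2 + r).
    by field.
  have -> : r * (2 * - ((2 + r) / 2) + 1) = - (r + r ^+ 2) by field.
  by rewrite r2 addrC.
rewrite -central_coef_shifted
  (shifted_quadratic_factor _ x a b) // exprMn -polyC_exp coefCM.
rewrite central_coef_factored !mulr_sumr; apply: eq_bigr => k _.
have lekn : (k <= n)%N by rewrite -ltnS.
have -> : b - a = ((1 - i) - (1 + i)) / r by rewrite /a /b; field.
rewrite /a !expr_div_n.
have rn : r ^- k * r ^- (n - k) = 2 ^- h.
  by rewrite -invfM -exprD subnKC // /n -mul2n exprM r2.
have xn : x ^+ n = (2 + r) ^+ n * 4 ^- h.
  have x2 : x ^+ 2 = (2 + r) ^+ 2 / 4 by rewrite /x; field.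
  by rewrite /n -mul2n exprM x2 exprMn [in RHS]exprM exprVn.
(* The factor 4^h clears the denominator of x^n and 2^h that of r^(-n). *)
have -> : 8 ^+ h = 4 ^+ h * 2 ^+ h :> F.
  by rewrite -exprMn; congr (_ ^+ _); ring.
transitivity (4 ^+ h * 2 ^+ h * x ^+ n * (r ^- k * r ^- (n - k)) *
  (('C(n, k) * 'C(n + k, k))%:R *
    ((1 + i) ^+ k * (1 - i - (1 + i)) ^+ (n - k)))).
  by ring.
rewrite rn xn; congr (_ * _); field.
by rewrite !expf_neq0 ?pnatr_eq0.
Qed.

(** * The value of D modulo p^2 *)

Lemma jacobi_sum_gauss_congr h : prime h.*2.+1 ->
    (h.*2.+1 = 1 %[mod 8] \/ h.*2.+1 = 7 %[mod 8])%N ->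
  exists2 E : algC, E \in Aint &
    \sum_(k < h.*2.+1) ('C(h.*2, k) * 'C(h.*2 + k, k))%:R *
      ((1 + 'i) ^+ k * ((1 - 'i) - (1 + 'i)) ^+ (h.*2 - k)) =
    2 * (-4) ^+ h - (-2) ^+ h + (h.*2.+1 ^ 2)%:R * E.
Proof.
move=> p_pr p_mod8.
have i2 := sqrCi algC.
have iA : 'i \in Aint by apply: (@root_sqr_Aint _ (-1)); rewrite i2.
have [e eqe] := jacobi_sum_expansion _ (1 + 'i) (1 - 'i : algC) _ p_pr.
have zp := exprn_1Di _ _ _ p_mod8 i2.
have wp : (1 - 'i) ^+ h.*2.+1 = 2 ^+ h * (1 + (-1) ^+ h * - 'i) :> algC.
  by apply: exprn_1Di; rewrite ?sqrrN.
set s := 1 - 'i - (1 + 'i) in eqe *.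
have sE : s = -2 * 'i by rewrite /s; ring.
have s0 : s != 0 by rewrite sE mulf_neq0 ?neq0Ci // oppr_eq0 pnatr_eq0.
have sA : s \in Aint by rewrite /s !(rpredB, rpredD, rpred1).
exists (\sum_(k < h.*2.+1) (e k)%:R * ((1 + 'i) ^+ k * s ^+ (h.*2 - k))).
  apply: rpred_sum => k _.
  rewrite rpredM ?rpred_nat //; apply: rpredM; apply: rpredX => //.
  exact: rpredD (rpred1 _) iA.
(* Here s = -2i, so s^p = s (-4)^h and w^p - z^p = s (-2)^h; the common factor s cancels. *)
apply: (mulfI s0); rewrite eqe wp zp.
have -> : s ^+ h.*2.+1 = s * (-4) ^+ h.
  rewrite exprS -mul2n exprM; congr (_ * _ ^+ _).
  by rewrite sE exprMn i2; ring.
have -> : (-2) ^+ h = (-1) ^+ h * 2 ^+ h :> algC by rewrite -exprMn mulN1r.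
by rewrite [in RHS]mulrDr; congr (_ + _); [rewrite sE|]; ring.
Qed.

(** * Integrality at p and the final congruence *)

(** The reduced denominator divides [b], so it inherits coprimality to p. *)
Lemma p_integral_denominator (p : nat) (x : rat) (a b : int) :
  coprimez p b -> b%:~R * x = a%:~R -> p_integral p x.
Proof.
rewrite /p_integral !coprimezE => cop bxa.
have den0 : (denq x)%:~R != 0 :> rat by rewrite intr_eq0 denq_neq0.
have x_den : x * (denq x)%:~R = (numq x)%:~R.
  by rewrite -{1}(divq_num_den x) divfK.
have eq_int : numq x * b = a * denq x.
  apply: (intr_inj (R := rat)); rewrite !rmorphM /= -bxa -mulrA x_den.
  exact: mulrC.
have : (denq x %| numq x * b)%Z by rewrite eq_int dvdz_mull.
rewrite Gauss_dvdzr; last by rewrite coprimezE coprime_sym coprime_num_den.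
by rewrite dvdzE => /coprime_dvdr; apply.
Qed.

Theorem theorem1p3 (p : nat) (p_prime : prime p)
    (p_mod8 : (p%:Z = 1 %[mod 8])%Z \/ (p%:Z = -1 %[mod 8])%Z) :
  p_congr p 3
    (\sum_(0 <= k < p)
       ('C(p.-1, k))%:R * ('C(k.*2, k))%:R
         * ((lucas_u 4 2 k)%:~R / (-2) ^+ k))
    ((-1) ^+ (p.-1 %/ 2) * (lucas_u 4 2 p.-1)%:~R).
Proof.
have {p_mod8} mod8 : (p = 1 %[mod 8] \/ p = 7 %[mod 8])%N.
  by case: p_mod8 => /eqP; rewrite eqz_mod_dvd; lia.
have [h ph] : exists h, p = h.*2.+1 by exists (p./2)%N; lia.
have -> : (p.-1 %/ 2 = h)%N by lia.
have cop8 : coprimez p (8 ^+ h).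
  rewrite coprimezE abszX coprimeXr //.
  by rewrite (@coprime_pexpr 3 _ 2) // coprimen2; lia.
rewrite big_mkord; subst p; rewrite /= in p_prime mod8 cop8 *.
set p := h.*2.+1 in p_prime mod8 cop8 *; set S := \sum_(k < p) _.
set u := lucas_u 4 2 h.*2.
have dvd_2h := prime_dvd_2exp_half _ p_prime mod8.
have /dvdzP[q qE] := dvd_2h.
have /dvdzP[v vE] := prime_dvd_lucas_u42 _ p_prime dvd_2h.
have [E EA] := jacobi_sum_gauss_congr _ p_prime mod8.
set D := \sum_(k < _) _ => DE.
have i2 := sqrCi algC.
pose r : algC := sqrtC 2.
have r2 : r ^+ 2 = 2 by exact: sqrtCK.
have r0 : r != 0 by rewrite -sqrf_eq0 r2 pnatr_eq0.
have binet k := lucas_u42_binet _ r k r2.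
(* D does not involve r, so the exact identity for r and for -r can be subtracted; Binet then acts
   on both sides at once. *)
have SE : 8 ^+ h * ratr S = D * u%:~R.
  have rr0 : 2 + r - (2 - r) != 0.
    by rewrite opprB addrC addrA subrK -mulr2n mulrn_eq0.
  apply: (mulfI rr0); rewrite [RHS]mulrCA binet mulrBr.
  rewrite ![D * _]mulrC -!sum_binom_central_2Dsqrt2 ?sqrrN //.
  rewrite -mulrBr mulrCA -sumrB rmorph_sum mulr_sumr; congr (_ * _).
  apply: eq_bigr => k _.
  rewrite !rmorphM fmorphV rmorphXn rmorphN !rmorph_nat /=.
  rewrite ratr_int mulrCA -mulrBr; congr (_ * _).
  have negE (y : algC) : - (y / 2) = y / (-2) by rewrite invrN mulrN.
  by rewrite mulrA binet mulrBl !negE !expr_div_n.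
(* The error p^2 E u equals p^3 E v and is rational, hence p^3 times an integer. *)
have [|||m mE] := @ratr_dvd_Aint (p%:Z ^+ 3)
    (8 ^+ h * S - (2 * (-4) ^+ h - (-2) ^+ h) * u%:~R) (E * v%:~R).
- by rewrite expf_neq0.
- by rewrite rpredM ?Aint_int.
- rewrite rmorphB !rmorphM rmorphB rmorphM.
  rewrite !rmorphXn !rmorphN !rmorph_nat /= ratr_int.
  rewrite SE DE.
  rewrite {1 2}/u vE intrM natrX -/p -[p%:~R]/(p%:R : algC); ring.
(* The second term comes from -(-1)^h x (x-1)^2 u with x = 2^h, x - 1 = q p and u = v p. *)
pose M : int := m - (-1) ^+ h * 2 ^+ h * q ^+ 2 * v.
have key : 8 ^+ h * (S - (-1) ^+ h * u%:~R) = (p ^ 3)%:R * M%:~R :> rat.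
  have q_rat : 2 ^+ h - 1 = q%:~R * p%:R :> rat.
    have := congr1 (fun a : int => a%:~R : rat) qE.
    by rewrite rmorphB rmorphM rmorphXn.
  have v_rat : u%:~R = v%:~R * p%:R :> rat by rewrite /u vE intrM.
  have m_rat : 8 ^+ h * S = p%:R ^+ 3 * m%:~R
      + (2 * (-4) ^+ h - (-2) ^+ h) * u%:~R.
    by apply/eqP; rewrite -subr_eq mE rmorphXn.
  have pow8 : 8 ^+ h = (2 ^+ h) ^+ 3 :> rat by rewrite -exprM mulnC exprM.
  have pow4 : (-4) ^+ h = (-1) ^+ h * (2 ^+ h) ^+ 2 :> rat.
    by rewrite -exprM mulnC exprM -exprMn; congr (_ ^+ _); ring.
  have powN2 : (-2) ^+ h = (-1) ^+ h * 2 ^+ h :> rat by rewrite -exprMn mulN1r.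
  rewrite mulrBr m_rat pow4 powN2 pow8.
  transitivity (p%:R ^+ 3 * m%:~R
      - (-1) ^+ h * 2 ^+ h * (2 ^+ h - 1) ^+ 2 * u%:~R : rat); first by ring.
  rewrite q_rat v_rat rmorphB !rmorphM !rmorphXn /= rmorphN natrX /=.
  by ring.
have pow8_0 : (8 ^+ h : rat) != 0 by rewrite expf_neq0.
have pow8_int : (8 ^+ h)%:~R = 8 ^+ h :> rat by rewrite rmorphXn.
have intR : (-1) ^+ h * u%:~R = ((-1) ^+ h * u)%:~R :> rat.
  by rewrite rmorphM rmorphXn.
split.
(* [key] also exhibits 8^h as a denominator of [S]. *)
- apply: (@p_integral_denominator _ _
    ((p ^ 3)%N%:Z * M + 8 ^+ h * ((-1) ^+ h * u)) _ cop8).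
  rewrite pow8_int rmorphD !rmorphM /= pow8_int.
  by rewrite -[(p ^ 3)%N%:~R]/((p ^ 3)%:R : rat) -key mulrBr intR rmorphM subrK.
- apply: (@p_integral_denominator _ _ ((-1) ^+ h * u) 1).
    by rewrite coprimezE coprimen1.
  by rewrite mul1r intR.
exists (M%:~R / 8 ^+ h).
  by apply: (p_integral_denominator _ _ M _ cop8); rewrite pow8_int mulrC divfK.
by rewrite mulrA -key mulrAC divff // mul1r.
Qed.
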